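(* Let $R$ be a prime ring with extended centroid $C$, let $K,L$ be noncentral Lie ideals of $R$, and let $m,n$ be positive integers. Then the following are equivalent: (i) $[K^m,L^n]=0$; (ii) $[K,L]=0$; (iii) $R$ is exceptional and $KC=LC=Ca+C$ for any noncentral element $a\in L$ (that is, for every $a\in L\setminus Z(R)$).
   Context: Rings are associative, not necessarily with unity. $Z(R)$ is the center of $R$, and $[x,y]:=xy-yx$. For subsets $A,B$ of a ring, $[A,B]$ (resp. $AB$) denotes the additive subgroup generated by all $[x,y]$ (resp. $xy$) with $x\in A$, $y\in B$; $K^m$ is the product of $m$ copies of $K$. A Lie ideal of $R$ is an additive subgroup $L$ with $[L,R]\subseteq L$; it is central if $L\subseteq Z(R)$, noncentral otherwise. $R$ is prime if $xRy=0$ implies $x=0$ or $y=0$. For $R$ prime, $Q_s(R)$ is the Martindale symmetric ring of quotients of $R$ (a prime ring containing $R$), and the extended centroid $C$ is the center of $Q_s(R)$, which is a field. $RC$, $KC$, $LC$ denote the $C$-spans of $R,K,L$ in $Q_s(R)$; $Ca+C=\{\beta a+\gamma:\beta,\gamma\in C\}$. A prime ring $R$ is exceptional if both $\operatorname{char} R=2$ and $\dim_C RC=4$. *)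

(* Defs.v *)
From HB Require Import structures.
From mathcomp Require Import all_boot all_algebra.
From mathcomp Require Import boolp classical_sets.

Set Implicit Arguments.
Unset Strict Implicit.
Unset Printing Implicit Defensive.

Import GRing.Theory.
Local Open Scope ring_scope.
Local Open Scope quotient_scope.
Local Open Scope classical_set_scope.

(* MathComp's rings are unital, hence a new structure. *)
HB.mixin Record Zmodule_isRng R of GRing.Zmodule R := {
  rmul : R -> R -> R;
  rmulA : associative rmul;
  rmulDl : left_distributive rmul +%R;
  rmulDr : right_distributive rmul +%R
}.

#[short(type="rngType")]
HB.structure Definition Rng := {R of GRing.Zmodule R & Zmodule_isRng R}.

Notation "x ** y" := (rmul x y) (at level 40, left associativity) : ring_scope.

(* Nontriviality excludes only the zero ring, which has no nonzero ideal to
   build the ring of quotients on and no noncentral Lie ideal. *)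
HB.mixin Record Rng_isPrime R of Rng R := {
  prime_nontrivial : exists x : R, x <> 0;
  prime_mul : forall x y : R,
    (forall r : R, x ** r ** y = 0) -> x = 0 \/ y = 0
}.

#[short(type="primeRngType")]
HB.structure Definition PrimeRng := {R of Rng R & Rng_isPrime R}.

Definition subgroup (V : zmodType) (A : set V) : Prop :=
  A 0 /\ forall x y, A x -> A y -> A (x - y).

Definition zgen (V : zmodType) (A : set V) : set V := smallest (@subgroup V) A.

Section RngSets.
Variable R : rngType.
Implicit Types (x y : R) (A B : set R).

Definition rcomm x y : R := x ** y - y ** x.

Definition rcenter : set R := [set x | forall y, x ** y = y ** x].

Definition set_mul A B : set R :=
  zgen [set z | exists x y, [/\ A x, B y & z = x ** y]].

Definition set_comm A B : set R :=
  zgen [set z | exists x y, [/\ A x, B y & z = rcomm x y]].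

(* A^m, meaningful for 0 < m only (R need not have a unity). *)
Definition set_pow A (m : nat) : set R := iter m.-1 (fun B => set_mul B A) A.

Definition lie_ideal A : Prop := subgroup A /\ set_comm A setT `<=` A.

Definition noncentral_lie_ideal A : Prop :=
  lie_ideal A /\ ~ (A `<=` rcenter).

Definition nz_ideal A : Prop :=
  [/\ subgroup A,
      forall r x, A x -> A (r ** x),
      forall r x, A x -> A (x ** r) &
      exists2 x, A x & x <> 0].

End RngSets.

(* A representative of an element q of the symmetric ring of quotients: a
   nonzero ideal I, a right R-module map f : I -> R (y |-> q y) and a left
   R-module map g : I -> R (x |-> x q) with x f(y) = g(x) y on I.  The values
   of f and g outside I are irrelevant. *)
Definition martindale_axiom (R : rngType) (I : set R) (f g : R -> R) : Prop :=
  [/\ nz_ideal I,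
      forall x y, I x -> I y -> f (x + y) = f x + f y /\ g (x + y) = g x + g y,
      forall x r, I x -> f (x ** r) = f x ** r,
      forall x r, I x -> g (r ** x) = r ** g x &
      forall x y, I x -> I y -> x ** f y = g x ** y].

Record martindale (R : rngType) := Martindale {
  mdom : set R;
  mlact : R -> R;
  mract : R -> R;
  martindaleP : martindale_axiom mdom mlact mract
}.

HB.instance Definition _ (R : rngType) := gen_eqMixin (martindale R).
HB.instance Definition _ (R : rngType) := gen_choiceMixin (martindale R).

Section SubgroupTheory.
Variable V : zmodType.
Implicit Types A B : set V.

Lemma zgen_subgroup A : subgroup (zgen A).
Proof.
split=> [B [[B0 _] _] //|x y Ax Ay B PB].
by have [[_ BB] _] := PB; apply: BB; [apply: Ax|apply: Ay].
Qed.

Lemma sub_zgen A : A `<=` zgen A.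
Proof. exact: sub_gen_smallest. Qed.

Lemma zgen_min A B : subgroup B -> A `<=` B -> zgen A `<=` B.
Proof. by move=> sB AB; apply: smallest_sub. Qed.

Lemma subgroupN A x : subgroup A -> A x -> A (- x).
Proof. by case=> A0 AB Ax; rewrite -sub0r; apply: AB. Qed.

Lemma subgroupD A x y : subgroup A -> A x -> A y -> A (x + y).
Proof.
move=> sA Ax Ay; rewrite -[y]opprK; apply: sA.2 => //; exact: subgroupN.
Qed.

Lemma subgroupI A B : subgroup A -> subgroup B -> subgroup (A `&` B).
Proof.
move=> [A0 AB] [B0 BB]; split=> // x y [Ax Bx] [Ay By].
by split; [apply: AB|apply: BB].
Qed.

End SubgroupTheory.

Section RngTheory.
Variable R : rngType.
Implicit Types x y z : R.

Lemma rmul0r x : 0 ** x = 0.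
Proof. by apply: (addrI (0 ** x)); rewrite -rmulDl !addr0. Qed.

Lemma rmulr0 x : x ** 0 = 0.
Proof. by apply: (addrI (x ** 0)); rewrite -rmulDr !addr0. Qed.

Lemma rmulNr x y : (- x) ** y = - (x ** y).
Proof. by apply: (addrI (x ** y)); rewrite -rmulDl !subrr rmul0r. Qed.

Lemma rmulrN x y : x ** (- y) = - (x ** y).
Proof. by apply: (addrI (x ** y)); rewrite -rmulDr !subrr rmulr0. Qed.

Lemma rmulBl x y z : (x - y) ** z = x ** z - y ** z.
Proof. by rewrite rmulDl rmulNr. Qed.

Lemma rmulBr x y z : z ** (x - y) = z ** x - z ** y.
Proof. by rewrite rmulDr rmulrN. Qed.

End RngTheory.

Section PrimeTheory.
Variable R : primeRngType.
Implicit Types (x y : R) (I J : set R).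

Lemma nz_ideal_mul_neq0 I J : nz_ideal I -> nz_ideal J ->
  exists x y, [/\ I x, J y & x ** y <> 0].
Proof.
move=> [_ _ Ir [x Ix x0]] [_ _ _ [y Jy y0]].
apply: contrapT => H.
have [] // := @prime_mul R x y.
by move=> r; apply: contrapT => xry; apply: H; exists (x ** r), y; split; auto.
Qed.

Lemma nz_ideal_annl I x : nz_ideal I -> (forall y, I y -> x ** y = 0) -> x = 0.
Proof.
move=> [_ Il _ [y Iy y0]] H.
have [] // := @prime_mul R x y.
by move=> r; rewrite -rmulA; apply/H/Il.
Qed.

Lemma nz_idealT : nz_ideal (@setT R).
Proof. by split=> //; have [x x0] := @prime_nontrivial R; exists x. Qed.

Lemma nz_idealI I J : nz_ideal I -> nz_ideal J -> nz_ideal (I `&` J).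
Proof.
move=> nI nJ; have [x [y [Ix Jy xy]]] := nz_ideal_mul_neq0 nI nJ.
have [sI Il Ir _] := nI; have [sJ Jl Jr _] := nJ.
split; first exact: subgroupI.
- by move=> r z [? ?]; split; auto.
- by move=> r z [? ?]; split; auto.
by exists (x ** y) => //; split; auto.
Qed.

Lemma nz_ideal_setmul I J : nz_ideal I -> nz_ideal J -> nz_ideal (set_mul I J).
Proof.
move=> nI nJ; have [x [y [Ix Jy xy]]] := nz_ideal_mul_neq0 nI nJ.
have [sI Il Ir _] := nI; have [sJ Jl Jr _] := nJ.
have sM := zgen_subgroup [set z | exists x y, [/\ I x, J y & z = x ** y]].
split=> //.
- move=> r; apply: (@zgen_min _ _ [set z | set_mul I J (r ** z)]).
    split=> [|a b Ma Mb] /=; first by rewrite rmulr0; apply: sM.1.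
    by rewrite rmulBr; apply: sM.2.
  move=> _ [a [b [Ia Jb ->]]] /=; rewrite rmulA; apply: sub_zgen.
  by exists (r ** a), b; split; auto.
- move=> r; apply: (@zgen_min _ _ [set z | set_mul I J (z ** r)]).
    split=> [|a b Ma Mb] /=; first by rewrite rmul0r; apply: sM.1.
    by rewrite rmulBl; apply: sM.2.
  move=> _ [a [b [Ia Jb ->]]] /=; rewrite -rmulA; apply: sub_zgen.
  by exists a, (b ** r); split; auto.
by exists (x ** y) => //; apply: sub_zgen; exists x, y.
Qed.

Lemma set_mul_subl I J : nz_ideal I -> set_mul I J `<=` I.
Proof.
move=> [sI _ Ir _]; apply: zgen_min => // _ [a [b [Ia _ ->]]]; exact: Ir.
Qed.

Lemma set_mul_subr I J : nz_ideal J -> set_mul I J `<=` J.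
Proof.
move=> [sJ Jl _ _]; apply: zgen_min => // _ [a [b [_ Jb ->]]]; exact: Jl.
Qed.

End PrimeTheory.

Section MartindaleOps.
Variable R : primeRngType.
Implicit Types p q : martindale R.

(* Equality of germs on nonzero ideals. *)
Definition meq p q : Prop :=
  exists J : set R, [/\ nz_ideal J, J `<=` mdom p, J `<=` mdom q &
    forall x, J x -> mlact p x = mlact q x /\ mract p x = mract q x].

Definition meqb p q : bool := `[< meq p q >].

Lemma mdom_nz p : nz_ideal (mdom p).
Proof. by case: (martindaleP p). Qed.

Lemma mlactD p x y : mdom p x -> mdom p y ->
  mlact p (x + y) = mlact p x + mlact p y.
Proof. by case: (martindaleP p) => _ H _ _ _ /H{}H /H[]. Qed.

Lemma mractD p x y : mdom p x -> mdom p y ->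
  mract p (x + y) = mract p x + mract p y.
Proof. by case: (martindaleP p) => _ H _ _ _ /H{}H /H[]. Qed.

Lemma mlactM p x r : mdom p x -> mlact p (x ** r) = mlact p x ** r.
Proof. by case: (martindaleP p) => _ _ H _ _; apply: H. Qed.

Lemma mractM p x r : mdom p x -> mract p (r ** x) = r ** mract p x.
Proof. by case: (martindaleP p) => _ _ _ H _; apply: H. Qed.

Lemma mbal p x y : mdom p x -> mdom p y -> x ** mlact p y = mract p x ** y.
Proof. by case: (martindaleP p) => _ _ _ _ H; apply: H. Qed.

Lemma mdom0 p : mdom p 0.
Proof. by case: (mdom_nz p) => -[]. Qed.

Lemma mlact0 p : mlact p 0 = 0.
Proof.
by apply: (addrI (mlact p 0)); rewrite -mlactD ?addr0 //; apply: mdom0.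
Qed.

Lemma mract0 p : mract p 0 = 0.
Proof.
by apply: (addrI (mract p 0)); rewrite -mractD ?addr0 //; apply: mdom0.
Qed.

Lemma mlactB p x y : mdom p x -> mdom p y ->
  mlact p (x - y) = mlact p x - mlact p y.
Proof.
move=> px py; have [sp _ _ _] := mdom_nz p; apply/eqP.
by rewrite -[_ == _](inj_eq (addIr (mlact p y))) -mlactD ?subrK //; apply: sp.2.
Qed.

Lemma mractB p x y : mdom p x -> mdom p y ->
  mract p (x - y) = mract p x - mract p y.
Proof.
move=> px py; have [sp _ _ _] := mdom_nz p; apply/eqP.
by rewrite -[_ == _](inj_eq (addIr (mract p y))) -mractD ?subrK //; apply: sp.2.
Qed.

Lemma meqbP p q : reflect (meq p q) (meqb p q).
Proof. exact: asboolP. Qed.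

Lemma meq_refl : reflexive meqb.
Proof. by move=> p; apply/meqbP; exists (mdom p); split=> //; apply: mdom_nz. Qed.

Lemma meq_sym : symmetric meqb.
Proof.
by move=> p q; apply/meqbP/meqbP => -[J [nJ Jp Jq H]]; exists J; split=> // x;
  case/H=> -> ->.
Qed.

Lemma meq_trans : transitive meqb.
Proof.
move=> q p r /meqbP[J [nJ Jp Jq H]] /meqbP[K [nK Kq Kr H']]; apply/meqbP.
exists (J `&` K); split; first exact: nz_idealI.
- by move=> x [/Jp].
- by move=> x [_ /Kr].
- by move=> x [/H[-> ->] /H'[-> ->]].
Qed.

Canonical meq_equiv := EquivRel meqb meq_refl meq_sym meq_trans.

Lemma mzero_axiom : martindale_axiom (@setT R) (fun=> 0) (fun=> 0).
Proof.
split=> //; first exact: nz_idealT.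
- by move=> x y; rewrite addr0.
- by move=> x r; rewrite rmul0r.
- by move=> x r; rewrite rmulr0.
- by move=> x y; rewrite rmul0r rmulr0.
Qed.

Lemma mone_axiom : martindale_axiom (@setT R) id id.
Proof. by split=> //; apply: nz_idealT. Qed.

Lemma membed_axiom (a : R) :
  martindale_axiom (@setT R) (fun y => a ** y) (fun x => x ** a).
Proof.
split; first exact: nz_idealT.
- by move=> x y _ _; rewrite rmulDl rmulDr.
- by move=> x r; rewrite rmulA.
- by move=> x r; rewrite rmulA.
- by move=> x y; rewrite rmulA.
Qed.

Lemma mopp_axiom p :
  martindale_axiom (mdom p) (fun y => - mlact p y) (fun x => - mract p x).
Proof.
split; first exact: mdom_nz.
- by move=> x y px py; rewrite mlactD // mractD // !opprD.
- by move=> x r px; rewrite mlactM // rmulNr.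
- by move=> x r px; rewrite mractM // rmulrN.
- by move=> x y px py; rewrite rmulrN rmulNr mbal.
Qed.

Lemma madd_axiom p q :
  martindale_axiom (mdom p `&` mdom q)
    (fun y => mlact p y + mlact q y) (fun x => mract p x + mract q x).
Proof.
split; first by apply: nz_idealI; apply: mdom_nz.
- by move=> x y [px qx] [py qy]; rewrite !mlactD // !mractD // addrACA;
    split=> //; rewrite addrACA.
- by move=> x r [px qx]; rewrite !mlactM // rmulDl.
- by move=> x r [px qx]; rewrite !mractM // rmulDr.
- by move=> x y [px qx] [py qy]; rewrite rmulDl rmulDr !mbal.
Qed.

Lemma mlact_prod p q x :
  set_mul (mdom q) (mdom p) x -> mdom p (mlact q x).
Proof.
have [sp pl pr _] := mdom_nz p; have [sq ql qr _] := mdom_nz q.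
suff H : set_mul (mdom q) (mdom p) `<=`
    [set x | mdom q x /\ mdom p (mlact q x)] by case/H.
apply: zgen_min.
  split=> [|a b [qa pa] [qb pb]].
    by split; [apply: mdom0|rewrite mlact0; apply: mdom0].
  by split; [apply: sq.2|rewrite mlactB //; apply: sp.2].
move=> _ [a [b [qa pb ->]]]; split; first exact: qr.
by rewrite mlactM //; apply: pl.
Qed.

Lemma mract_prod p q x :
  set_mul (mdom q) (mdom p) x -> mdom q (mract p x).
Proof.
have [sp pl pr _] := mdom_nz p; have [sq ql qr _] := mdom_nz q.
suff H : set_mul (mdom q) (mdom p) `<=`
    [set x | mdom p x /\ mdom q (mract p x)] by case/H.
apply: zgen_min.
  split=> [|a b [qa pa] [qb pb]].
    by split; [apply: mdom0|rewrite mract0; apply: mdom0].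
  by split; [apply: sp.2|rewrite mractB //; apply: sq.2].
move=> _ [a [b [qa pb ->]]]; split; first exact: pl.
by rewrite mractM //; apply: qr.
Qed.

Lemma mmul_axiom p q :
  martindale_axiom (set_mul (mdom q) (mdom p))
    (fun y => mlact p (mlact q y)) (fun x => mract q (mract p x)).
Proof.
have np := mdom_nz p; have nq := mdom_nz q.
have Mp := set_mul_subr (I := mdom q) np.
have Mq := set_mul_subl (J := mdom p) nq.
split; first exact: nz_ideal_setmul.
- move=> x y Mx My; have [px py] := (Mp _ Mx, Mp _ My).
  have [qx qy] := (Mq _ Mx, Mq _ My).
  rewrite (mlactD qx qy) (mractD px py).
  by rewrite mlactD ?mractD //; (exact: mlact_prod || exact: mract_prod).
- by move=> x r Mx; rewrite mlactM ?mlactM //; [exact: mlact_prod|exact: Mq].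
- by move=> x r Mx; rewrite mractM ?mractM //; [exact: mract_prod|exact: Mp].
- move=> x y Mx My; rewrite mbal ?mbal //; first exact: mract_prod.
  + exact: Mq.
  + exact: Mp.
  + exact: mlact_prod.
Qed.

Definition mzero := Martindale mzero_axiom.
Definition mone := Martindale mone_axiom.
Definition membed (a : R) := Martindale (membed_axiom a).
Definition mopp p := Martindale (mopp_axiom p).
Definition madd p q := Martindale (madd_axiom p q).
Definition mmul p q := Martindale (mmul_axiom p q).

End MartindaleOps.

Definition Qs (R : primeRngType) : Type := {eq_quot (@meq_equiv R)}.
HB.instance Definition _ (R : primeRngType) := Choice.on (Qs R).
HB.instance Definition _ (R : primeRngType) := EqQuotient.on (Qs R).

Section QsRing.
Variable R : primeRngType.
Implicit Types (p q : martindale R) (x y z : Qs R).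

Definition qpi p : Qs R := \pi_(Qs R) p.

Lemma qpi_eq p q : meq p q -> qpi p = qpi q.
Proof. by move=> pq; apply/eqmodP/meqbP. Qed.

Lemma qpi_meq p q : qpi p = qpi q -> meq p q.
Proof. by move/eqmodP/meqbP. Qed.

Lemma meq_repr p : meq (repr (qpi p)) p.
Proof. by apply: qpi_meq; rewrite /qpi reprK. Qed.

Lemma qpiK x : qpi (repr x) = x.
Proof. exact: reprK. Qed.

Definition qzero : Qs R := qpi (mzero R).
Definition qone : Qs R := qpi (mone R).
Definition qopp x : Qs R := qpi (mopp (repr x)).
Definition qadd x y : Qs R := qpi (madd (repr x) (repr y)).
Definition qmul x y : Qs R := qpi (mmul (repr x) (repr y)).

Lemma qpiN p : qopp (qpi p) = qpi (mopp p).
Proof.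
apply: qpi_eq; have [J [nJ J1 J2 H]] := meq_repr p.
by exists J; split=> //= x /H[-> ->].
Qed.

Lemma qpiD p q : qadd (qpi p) (qpi q) = qpi (madd p q).
Proof.
apply: qpi_eq; have [J [nJ J1 J2 H]] := meq_repr p.
have [K [nK K1 K2 H']] := meq_repr q.
exists (J `&` K); split=> /=; first exact: nz_idealI.
- by move=> x [/J1 ? /K1 ?].
- by move=> x [/J2 ? /K2 ?].
- by move=> x [/H[-> ->] /H'[-> ->]].
Qed.

Lemma set_mulS (A A' B B' : set R) :
  A `<=` A' -> B `<=` B' -> set_mul A B `<=` set_mul A' B'.
Proof.
move=> AA BB; apply: zgen_min; first exact: zgen_subgroup.
by move=> _ [a [b [/AA ? /BB ? ->]]]; apply: sub_zgen; exists a, b.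
Qed.

(* On K J both actions of the two products agree, K and J being ideals on which
   the representatives of q, resp. p, agree. *)
Lemma qpiM p q : qmul (qpi p) (qpi q) = qpi (mmul p q).
Proof.
apply: qpi_eq; have [J [nJ J1 J2 H]] := meq_repr p.
have [K [nK K1 K2 H']] := meq_repr q.
have KJ1 := set_mulS K1 J1; have KJ2 := set_mulS K2 J2.
have [sJ Jl Jr _] := nJ; have [sK Kl Kr _] := nK.
exists (set_mul K J); split=> //=; first exact: nz_ideal_setmul.
have HK : set_mul K J `<=` [set x | K x /\ J (mlact q x)].
  apply: zgen_min.
    split=> [|a b [Ka Ja] [Kb Jb]].
      by split; [apply: sK.1|rewrite mlact0; apply: sJ.1].
    by split; [apply: sK.2|rewrite mlactB; [apply: sJ.2|apply: K2|apply: K2]].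
  move=> _ [a [b [Ka Jb ->]]]; split; first exact: Kr.
  by rewrite mlactM; [apply: Jl|apply: K2].
have HJ : set_mul K J `<=` [set x | J x /\ K (mract p x)].
  apply: zgen_min.
    split=> [|a b [Ka Ja] [Kb Jb]].
      by split; [apply: sJ.1|rewrite mract0; apply: sK.1].
    by split; [apply: sJ.2|rewrite mractB; [apply: sK.2|apply: J2|apply: J2]].
  move=> _ [a [b [Ka Jb ->]]]; split; first exact: Jl.
  by rewrite mractM; [apply: Kr|apply: J2].
move=> x Mx; have [Kx Jqx] := HK _ Mx; have [Jx Kpx] := HJ _ Mx.
have [-> _] := H' _ Kx; have [_ ->] := H _ Jx.
by have [-> _] := H _ Jqx; have [_ ->] := H' _ Kpx.
Qed.

Lemma meq_on p q (J : set R) : nz_ideal J -> J `<=` mdom p -> J `<=` mdom q ->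
  (forall t, J t -> mlact p t = mlact q t) ->
  (forall t, J t -> mract p t = mract q t) -> qpi p = qpi q.
Proof.
by move=> nJ Jp Jq H1 H2; apply: qpi_eq; exists J; split=> // x Jx; split; auto.
Qed.

Lemma meq_domI p q :
  (forall t, mdom p t -> mdom q t -> mlact p t = mlact q t) ->
  (forall t, mdom p t -> mdom q t -> mract p t = mract q t) -> qpi p = qpi q.
Proof.
move=> H1 H2; apply: (@meq_on _ _ (mdom p `&` mdom q)).
- by apply: nz_idealI; apply: mdom_nz.
- by move=> x [].
- by move=> x [].
- by move=> x [? ?]; apply: H1.
- by move=> x [? ?]; apply: H2.
Qed.

Lemma qaddA : associative qadd.
Proof.
move=> x y z; rewrite -(qpiK x) -(qpiK y) -(qpiK z) !qpiD.
by apply: meq_domI => t _ _ /=; rewrite addrA.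
Qed.

Lemma qaddC : commutative qadd.
Proof.
move=> x y; rewrite -(qpiK x) -(qpiK y) !qpiD.
by apply: meq_domI => t _ _ /=; rewrite addrC.
Qed.

Lemma qadd0 : left_id qzero qadd.
Proof.
move=> x; rewrite -(qpiK x) /qzero qpiD.
by apply: meq_domI => t _ _ /=; rewrite add0r.
Qed.

Lemma qaddN : left_inverse qzero qopp qadd.
Proof.
move=> x; rewrite -(qpiK x) /qzero qpiN qpiD.
by apply: meq_domI => t _ _ /=; rewrite addNr.
Qed.

Lemma qmulA : associative qmul.
Proof.
move=> x y z; rewrite -(qpiK x) -(qpiK y) -(qpiK z) !qpiM.
by apply: meq_domI.
Qed.

Lemma qmul1l : left_id qone qmul.
Proof. by move=> x; rewrite -(qpiK x) /qone qpiM; apply: meq_domI. Qed.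

Lemma qmul1r : right_id qone qmul.
Proof. by move=> x; rewrite -(qpiK x) /qone qpiM; apply: meq_domI. Qed.

Lemma qmulDl : left_distributive qmul qadd.
Proof.
move=> x y z; rewrite -(qpiK x) -(qpiK y) -(qpiK z) qpiD !qpiM qpiD.
set p := repr x; set q := repr y; set r := repr z.
apply: meq_domI => //= t Mt [_ _]; rewrite mractD //.
  exact: (@mract_prod _ p r _ (set_mulS (fun _ => id) (@subIsetl _ _ _) Mt)).
exact: (@mract_prod _ q r _ (set_mulS (fun _ => id) (@subIsetr _ _ _) Mt)).
Qed.

Lemma qmulDr : right_distributive qmul qadd.
Proof.
move=> x y z; rewrite -(qpiK x) -(qpiK y) -(qpiK z) qpiD !qpiM qpiD.
set p := repr x; set q := repr y; set r := repr z.
apply: meq_domI => //= t Mt [_ _]; rewrite mlactD //.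
  exact: (@mlact_prod _ p q _ (set_mulS (@subIsetl _ _ _) (fun _ => id) Mt)).
exact: (@mlact_prod _ p r _ (set_mulS (@subIsetr _ _ _) (fun _ => id) Mt)).
Qed.

HB.instance Definition _ :=
  GRing.isZmodule.Build (Qs R) qaddA qaddC qadd0 qaddN.
HB.instance Definition _ :=
  GRing.Zmodule_isPzRing.Build (Qs R) qmulA qmul1l qmul1r qmulDl qmulDr.

Definition toQ (a : R) : Qs R := qpi (membed a).

Lemma toQ_inj : injective toQ.
Proof.
move=> a b /qpi_meq[J [nJ _ _ H]]; apply/eqP; rewrite -subr_eq0; apply/eqP.
apply: (nz_ideal_annl nJ) => y Jy; have [/= ab _] := H _ Jy.
by rewrite rmulBl ab subrr.
Qed.

Lemma toQD a b : toQ (a + b) = toQ a + toQ b.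
Proof.
rewrite -[RHS]/(qadd _ _) qpiD.
by apply: meq_domI => t _ _ /=; rewrite ?rmulDl ?rmulDr.
Qed.

Lemma toQM a b : toQ (a ** b) = toQ a * toQ b.
Proof.
rewrite -[RHS]/(qmul _ _) qpiM.
by apply: meq_domI => t _ _ /=; rewrite rmulA.
Qed.

End QsRing.

Section ExtendedCentroid.
Variable R : primeRngType.

Definition ext_centroid : set (Qs R) := [set c | forall q, c * q = q * c].

Definition Cspan (A : set (Qs R)) : set (Qs R) :=
  [set q | exists n (c a : 'I_n -> Qs R),
    [/\ forall i, ext_centroid (c i), forall i, A (a i) &
        q = \sum_(i < n) c i * a i]].

Definition Cspan_sub (A : set R) : set (Qs R) := Cspan (@toQ R @` A).

Definition Cfree n (b : 'I_n -> Qs R) : Prop :=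
  forall c : 'I_n -> Qs R, (forall i, ext_centroid (c i)) ->
    \sum_(i < n) c i * b i = 0 -> forall i, c i = 0.

Definition Cdim_eq (V : set (Qs R)) (n : nat) : Prop :=
  exists b : 'I_n -> Qs R, Cfree b /\ V = Cspan (range b).

Definition Caff (a : R) : set (Qs R) :=
  [set q | exists beta gamma, [/\ ext_centroid beta, ext_centroid gamma &
    q = beta * toQ a + gamma]].

(* R being nonzero, it has characteristic 2 exactly when 2R = 0. *)
Definition exceptional : Prop :=
  (forall x : R, x *+ 2 = 0) /\ Cdim_eq (Cspan_sub setT) 4.

End ExtendedCentroid.

Arguments exceptional : clear implicits.

(* Main.v *)
Require Import Defs.
From HB Require Import structures.
From mathcomp Require Import all_boot all_algebra.
From mathcomp Require Import boolp classical_sets.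
Import GRing.Theory.
Local Open Scope ring_scope.
Local Open Scope classical_set_scope.

(* Martindale's lemma: if sum_i a_i x b_i = 0 for all x in R and the b_i are
   independent over C, then every a_i is 0.

   Let w in R be noncentral and k in R \ (C w + C).  Applied to the identity
   [p [k, x], w] = 0 in x, the lemma yields a scalar b depending on k and w only
   such that w p = b p for every p satisfying the identity.  If K^m commutes with
   w, this identity holds for all k in K and p in K^(m-1) (with p = 1 when
   m = 1), so that (w - b) K^(m-1) = 0, which forces w = b.  Hence K lies in
   C w + C: the centralizer of K^m is that of K, and (i) <-> (ii) follows.

   If K and L commute, the same argument puts both into C a + C for a noncentral
   a in L, and [a, [a, x]] = 0 for all x.  Martindale's lemma gives char R = 2 and
   a^2 in C.  Some commutator w = [a, y] has w^2 <> 0, hence is invertible in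
   C a + C, and 1, a, y, a y is a basis of RC. *)

Section PrimeRings.

Set Implicit Arguments.
Unset Strict Implicit.
Unset Printing Implicit Defensive.

Variable R : primeRngType.
Implicit Types (a k w x y z : R) (c p q : Qs R) (I J K L : set R).

Local Notation C := (@ext_centroid R).

(** * Annihilators and primeness in the symmetric ring of quotients *)

Lemma nz_ideal_annr J x : nz_ideal J -> (forall y, J y -> y ** x = 0) -> x = 0.
Proof.
move=> [_ _ Jr [y Jy y0]] H; have [] // := @prime_mul R y x.
by move=> r; apply/H/Jr.
Qed.

Lemma toQ0 : toQ (0 : R) = 0.
Proof. by apply: (addrI (toQ (0 : R))); rewrite -toQD !addr0. Qed.

Lemma toQN x : toQ (- x) = - toQ x.
Proof. by apply: (addrI (toQ x)); rewrite -toQD !subrr toQ0. Qed.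

Lemma toQB x y : toQ (x - y) = toQ x - toQ y.
Proof. by rewrite toQD toQN. Qed.

Lemma toQ_sum (I : Type) (s : seq I) (F : I -> R) :
  toQ (\sum_(i <- s) F i) = \sum_(i <- s) toQ (F i).
Proof.
by elim: s => [|i s IHs]; rewrite ?big_nil ?toQ0 // !big_cons toQD IHs.
Qed.

Lemma qpi_toQ (p : martindale R) y :
  mdom p y -> qpi p * toQ y = toQ (mlact p y).
Proof.
move=> py; rewrite -[LHS]/(qmul _ _) qpiM; apply: meq_domI => /= t Mt _.
  by rewrite mlactM.
by rewrite mbal //; apply: set_mul_subr Mt; apply: mdom_nz.
Qed.

Lemma toQ_qpi (p : martindale R) x :
  mdom p x -> toQ x * qpi p = toQ (mract p x).
Proof.
move=> px; rewrite -[LHS]/(qmul _ _) qpiM; apply: meq_domI => /= t Mt _.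
  by rewrite mbal //; apply: set_mul_subl Mt; apply: mdom_nz.
by rewrite mractM.
Qed.

Lemma Qs_dom q : exists2 J, nz_ideal J & forall y, J y ->
  (exists z, q * toQ y = toQ z) /\ (exists z, toQ y * q = toQ z).
Proof.
exists (mdom (repr q)); first exact: mdom_nz.
move=> y Jy; rewrite -{1 2}(qpiK q); split.
  by exists (mlact (repr q) y); rewrite qpi_toQ.
by exists (mract (repr q) y); rewrite toQ_qpi.
Qed.

Lemma Qs_annl J q : nz_ideal J -> (forall y, J y -> q * toQ y = 0) -> q = 0.
Proof.
move=> nJ H; set p := repr q.
have nK : nz_ideal (J `&` mdom p) by apply: nz_idealI => //; apply: mdom_nz.
have pl t : (J `&` mdom p) t -> mlact p t = 0.
  move=> [Jt pt]; apply: (@toQ_inj R).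
  by rewrite toQ0 -(H _ Jt) -qpi_toQ // qpiK.
rewrite -(qpiK q); apply: (@meq_on _ p (mzero R) (J `&` mdom p)) => //=.
(* The balance condition carries the vanishing of the left action over to the right one:
   [mract p t ** y = t ** mlact p y]. *)
move=> t [Jt pt]; apply: (nz_ideal_annl nK) => y Ky.
  by rewrite -mbal ?pl ?rmulr0 //; case: Ky.
Qed.

Lemma Qs_annr J q : nz_ideal J -> (forall y, J y -> toQ y * q = 0) -> q = 0.
Proof.
move=> nJ H; have [I nI HI] := Qs_dom q; apply: (Qs_annl nI) => y Iy.
have [[z qz] _] := HI _ Iy; rewrite qz; suff -> : z = 0 by rewrite toQ0.
apply: (nz_ideal_annr nJ) => x Jx; apply: (@toQ_inj R).
by rewrite toQM -qz mulrA H // mul0r toQ0.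
Qed.

(** If both were nonzero, some y p and q z would be nonzero elements u and v of R with u R v = 0. *)
Lemma Qs_prime p q : (forall x, p * toQ x * q = 0) -> p = 0 \/ q = 0.
Proof.
move=> H; apply: contrapT => /not_orP[p0 q0].
have [I nI HI] := Qs_dom p; have [J nJ HJ] := Qs_dom q.
apply: p0; apply: (Qs_annr nI) => y Iy; apply: contrapT => yp0.
apply: q0; apply: (Qs_annl nJ) => z Jz; apply: contrapT => qz0.
have [_ [u yp]] := HI _ Iy; have [[v qz] _] := HJ _ Jz.
case: (@prime_mul R u v) => [r|u0|v0].
- have : toQ y * (p * toQ r * q) * toQ z = 0 by rewrite H mulr0 mul0r.
  by move=> yz0; apply: (@toQ_inj R); rewrite !toQM -yp -qz toQ0 -yz0 !mulrA.
- by apply: yp0; rewrite yp u0 toQ0.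
- by apply: qz0; rewrite qz v0 toQ0.
Qed.

(** * The extended centroid as a field *)

(** For y in a suitable nonzero ideal both y and p y lie in R, so q commutes with them and q p y = p
    q y. *)
Lemma ext_centroidP q : C q <-> forall x, q * toQ x = toQ x * q.
Proof.
split=> [Cq x|H p]; first exact: Cq.
have [J nJ HJ] := Qs_dom p; apply/eqP; rewrite -subr_eq0; apply/eqP.
apply: (Qs_annl nJ) => y /HJ[[z pz] _].
by rewrite mulrBl -mulrA pz H -pz -!mulrA H subrr.
Qed.

Lemma ext_centroid_toQ x : C (toQ x) <-> rcenter x.
Proof.
split=> [Cx y|Zx].
  by apply: (@toQ_inj R); rewrite !toQM; apply: Cx.
by apply/ext_centroidP => y; rewrite -!toQM Zx.
Qed.

Lemma Qs_nontrivial : (1 : Qs R) <> 0.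
Proof.
have [x x0] := @prime_nontrivial R => H; apply: x0; apply: (@toQ_inj R).
by rewrite toQ0 -(mul1r (toQ x)) H mul0r.
Qed.

Lemma ext_centroid0 : C 0. Proof. by move=> q; rewrite mul0r mulr0. Qed.
Lemma ext_centroid1 : C 1. Proof. by move=> q; rewrite mul1r mulr1. Qed.
Lemma ext_centroidN c : C c -> C (- c).
Proof. by move=> Cc q; rewrite mulNr mulrN Cc. Qed.
Lemma ext_centroidD c d : C c -> C d -> C (c + d).
Proof. by move=> Cc Cd q; rewrite mulrDl mulrDr Cc Cd. Qed.
Lemma ext_centroidM c d : C c -> C d -> C (c * d).
Proof. by move=> Cc Cd q; rewrite -mulrA Cd mulrA Cc mulrA. Qed.

Lemma ext_centroid_mul_eq0 c q : C c -> c * q = 0 -> c = 0 \/ q = 0.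
Proof.
move=> Cc cq; apply: Qs_prime => x.
by rewrite Cc -mulrA cq mulr0.
Qed.

(** The list [s] stands for a tensor over R acting on [a], so that one tensor can be evaluated at
    several elements. *)
Definition biprod a (s : seq (R * R)) := \sum_(t <- s) t.1 ** a ** t.2.

Lemma biprod_cat a s t : biprod a (s ++ t) = biprod a s + biprod a t.
Proof. by rewrite /biprod big_cat. Qed.

Lemma biprodN a s :
  biprod a [seq (- t.1, t.2) | t <- s] = - biprod a s.
Proof.
rewrite /biprod big_map -sumrN; apply: eq_bigr => t _ /=.
by rewrite !rmulNr.
Qed.

Lemma biprodMl a s r :
  biprod a [seq (r ** t.1, t.2) | t <- s] = r ** biprod a s.
Proof.
rewrite /biprod big_map; elim: s => [|t s IHs].
  by rewrite !big_nil rmulr0.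
by rewrite !big_cons /= IHs rmulDr !rmulA.
Qed.

Lemma biprodMr a s r :
  biprod a [seq (t.1, t.2 ** r) | t <- s] = biprod a s ** r.
Proof.
rewrite /biprod big_map; elim: s => [|t s IHs].
  by rewrite !big_nil rmul0r.
by rewrite !big_cons /= IHs rmulDl !rmulA.
Qed.

(* The bimodule map x a0 y |-> x a y on the ideal R a0 R is well defined, so it
   is an element of the extended centroid. *)
Lemma ext_centroid_ratio a0 a : a0 <> 0 ->
  (forall s, biprod a0 s = 0 -> biprod a s = 0) ->
  exists2 c, C c & toQ a = c * toQ a0.
Proof.
move=> a00 H; pose J : set R := [set x | exists s, x = biprod a0 s].
(* By [fE] the choice of the list does not matter; the default 0 occurs only outside [J]. *)
pose f x := if pselect (J x) is left Jx then biprod a (projT1 (cid Jx)) else 0.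
have fE s : f (biprod a0 s) = biprod a s.
  rewrite /f; case: pselect => [Js|[]]; last by exists s.
  case: cid => /= t st; apply/eqP; rewrite eq_sym -subr_eq0 -biprodN.
  by rewrite -biprod_cat H // biprod_cat biprodN st subrr.
have ax : martindale_axiom J f f.
  split.
  - split.
    + split; first by exists [::]; rewrite /biprod big_nil.
      move=> _ _ [s ->] [t ->]; exists (s ++ [seq (- t.1, t.2) | t <- t]).
      by rewrite biprod_cat biprodN.
    + by move=> r _ [s ->]; exists [seq (r ** t.1, t.2) | t <- s]; rewrite biprodMl.
    + by move=> r _ [s ->]; exists [seq (t.1, t.2 ** r) | t <- s]; rewrite biprodMr.
    + apply: contrapT => J0; apply: a00.
      apply: (nz_ideal_annr (nz_idealT R)) => x _.
      apply: (nz_ideal_annl (nz_idealT R)) => y _.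
      apply: contrapT => xy0; apply: J0; exists (x ** a0 ** y) => //.
      by exists [:: (x, y)]; rewrite /biprod big_seq1.
  - by move=> _ _ [s ->] [t ->]; rewrite -biprod_cat !fE biprod_cat.
  - by move=> _ r [s ->]; rewrite -biprodMr !fE biprodMr.
  - by move=> _ r [s ->]; rewrite -biprodMl !fE biprodMl.
  - move=> _ _ [s ->] [t ->]; rewrite !fE -biprodMl -fE biprodMl.
    by rewrite -biprodMr fE biprodMr.
pose p := Martindale ax.
have pE s : qpi p * toQ (biprod a0 s) = toQ (biprod a s).
  by rewrite qpi_toQ /= ?fE //; exists s.
have Cp : C (qpi p).
  apply/ext_centroidP => x; apply/eqP; rewrite -subr_eq0; apply/eqP.
  apply: (Qs_annl (mdom_nz p)) => _ [s ->].
  rewrite mulrBl -!mulrA -toQM -biprodMl !pE biprodMl toQM.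
  by rewrite subrr.
(* Without a unity [a0] need not lie in R a0 R, so the equality is tested after multiplying by x on
   the left and y on the right. *)
exists (qpi p) => //; apply/eqP; rewrite -subr_eq0; apply/eqP.
apply: (Qs_annr (nz_idealT R)) => x _; apply: (Qs_annl (nz_idealT R)) => y _.
rewrite mulrBr mulrA -Cp mulrBl -!mulrA -!toQM.
have := pE [:: (x, y)]; rewrite /biprod !big_seq1 /= -!rmulA => ->.
by rewrite subrr.
Qed.

(** When z = c y is a nonzero element of R, the ratio of y to z given by [ext_centroid_ratio] is
    inverse to c. *)
Lemma ext_centroid_inv c : C c -> c <> 0 -> exists2 d, C d & d * c = 1.
Proof.
move=> Cc c0; have [J nJ HJ] := Qs_dom c.
have [y [Jy cy0]] : exists y, J y /\ c * toQ y <> 0.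
  apply: contrapT => H; apply: c0; apply: (Qs_annl nJ) => y Jy.
  by apply: contrapT => cy0; apply: H; exists y.
have [[z cz] _] := HJ _ Jy.
have z0 : z <> 0 by move=> z0; apply: cy0; rewrite cz z0 toQ0.
have czE s : toQ (biprod z s) = c * toQ (biprod y s).
  rewrite /biprod !toQ_sum mulr_sumr; apply: eq_bigr => t _.
  by rewrite !toQM -cz !mulrA -Cc.
have [s zs0|d Cd yE] := @ext_centroid_ratio z y z0.
  have : c * toQ (biprod y s) = 0 by rewrite -czE zs0 toQ0.
  case/(ext_centroid_mul_eq0 Cc) => // ys0; apply: (@toQ_inj R).
  by rewrite ys0 toQ0.
exists d => //; apply/eqP; rewrite -subr_eq0; apply/eqP.
have : (d * c - 1) * toQ y = 0.
  by rewrite mulrBl mul1r -mulrA cz -yE subrr.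
case/ext_centroid_mul_eq0 => //.
  apply: ext_centroidD; first exact: ext_centroidM.
  exact/ext_centroidN/ext_centroid1.
by move=> y0; case: cy0; rewrite y0 mulr0.
Qed.

(** * Linear independence over C and Martindale's lemma *)

Fixpoint lin_span (s : seq (Qs R)) : set (Qs R) :=
  if s is b :: s' then [set q | exists2 c, C c & lin_span s' (q - c * b)]
  else [set 0].

(** Triangular form of linear independence over the field C; it lets [gpi_toQ] peel off the head of
    the list. *)
Fixpoint lin_free (s : seq (Qs R)) : Prop :=
  if s is b :: s' then ~ lin_span s' b /\ lin_free s' else True.

Lemma lin_span_sum (I : eqType) (s : seq I) (c b : I -> Qs R) :
  {in s, forall i, C (c i)} ->
  lin_span [seq b i | i <- s] (\sum_(i <- s) c i * b i).
Proof.
elim: s => [|i s IHs] H; first by rewrite big_nil.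
rewrite big_cons /=; exists (c i); first by apply: H; rewrite mem_head.
rewrite addrC addKr; apply: IHs => j js; apply: H.
by rewrite in_cons js orbT.
Qed.

(** Martindale's lemma with coefficients in R. If the head coefficient were nonzero, every other one
    would be a C-multiple of it, and primeness would put the head of the [b i] in the span of the
    rest. *)
Lemma gpi_toQ (I : eqType) (s : seq I) (b : I -> Qs R) :
  lin_free [seq b i | i <- s] -> forall a : I -> R,
  (forall x, \sum_(i <- s) toQ (a i) * toQ x * b i = 0) ->
  {in s, forall i, a i = 0}.
Proof.
elim: s => [//|i s IHs] /= [bi fs] a H.
have ai : a i = 0.
  apply: contrapT => ai0.
  have ratio j : exists c, j \in s -> C c /\ toQ (a j) = c * toQ (a i).
    have [js|] := boolP (j \in s); last by exists 0.
    have [t t0|c Cc ac] := @ext_centroid_ratio (a i) (a j) ai0; last by exists c.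
    (* Evaluating [t] at every coefficient preserves the identity and kills its head, so the
       induction hypothesis applies. *)
    apply: (IHs fs (fun j => biprod (a j) t)) => // x.
    transitivity (\sum_(j <- i :: s) toQ (biprod (a j) t) * toQ x * b j).
      by rewrite big_cons t0 toQ0 !mul0r add0r.
    under eq_bigr => k _ do rewrite /biprod toQ_sum 2!mulr_suml.
    rewrite exchange_big big1 // => -[u v] _ /=.
    transitivity (toQ u * \sum_(k <- i :: s) toQ (a k) * toQ (v ** x) * b k).
      by rewrite mulr_sumr; apply: eq_bigr => k _; rewrite !toQM !mulrA.
    by rewrite H mulr0.
  have [c Hc] := boolp.choice ratio.
  have : b i + \sum_(j <- s) c j * b j = 0.
    have [|ai0'|//] := @Qs_prime (toQ (a i)) (b i + \sum_(j <- s) c j * b j).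
      move=> x; rewrite -[RHS](H x) big_cons mulrDr; congr (_ + _).
      rewrite mulr_sumr; apply: eq_big_seq => j js.
      have [Cc ->] := Hc j js.
      by rewrite mulrA -Cc !mulrA.
    by case: ai0; apply: (@toQ_inj R); rewrite ai0' toQ0.
  move/eqP; rewrite addr_eq0 -sumrN => /eqP biE; apply: bi; rewrite biE.
  under eq_bigr do rewrite -mulNr.
  by apply: lin_span_sum => j /Hc[Cc _]; apply: ext_centroidN.
move=> j; rewrite in_cons => /orP[/eqP->//|]; apply: IHs => // x.
by have := H x; rewrite big_cons ai toQ0 !mul0r add0r.
Qed.

(** Left multiplication by y in a suitable nonzero ideal brings all the coefficients into R, where
    [gpi_toQ] applies. *)
Lemma gpi (s : seq (Qs R * Qs R)) : lin_free [seq t.2 | t <- s] ->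
  (forall x, \sum_(t <- s) t.1 * toQ x * t.2 = 0) ->
  {in s, forall t, t.1 = 0}.
Proof.
move=> fs H.
have [J nJ HJ] : exists2 J, nz_ideal J & forall y, J y ->
    {in s, forall t, exists z, toQ y * t.1 = toQ z}.
  elim: s {fs H} => [|t s [J nJ HJ]]; first by exists setT => //; apply: nz_idealT.
  have [I nI HI] := Qs_dom t.1; exists (I `&` J); first exact: nz_idealI.
  move=> y [Iy Jy] u; rewrite in_cons => /orP[/eqP->|us]; last exact: HJ.
  by have [] := HI _ Iy.
move=> t ts; apply: (Qs_annr nJ) => y Jy.
have zP u : exists z, u \in s -> toQ y * u.1 = toQ z.
  have [us|] := boolP (u \in s); last by exists 0.
  by have [z Hz] := HJ y Jy u us; exists z.
have [z Hz] := boolp.choice zP.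
rewrite Hz // (gpi_toQ fs (a := z)) ?toQ0 // => x.
transitivity (toQ y * \sum_(u <- s) u.1 * toQ x * u.2); last by rewrite H mulr0.
by rewrite mulr_sumr; apply: eq_big_seq => u us; rewrite -Hz // !mulrA.
Qed.

(** * The subspaces C a + C *)

Lemma toQ_rcomm x y : toQ (rcomm x y) = toQ x * toQ y - toQ y * toQ x.
Proof. by rewrite /rcomm toQB !toQM. Qed.

Lemma lin_span1 q : lin_span [:: 1] q <-> C q.
Proof.
split=> [[c Cc /eqP]|Cq]; last by exists q; rewrite //= mulr1 subrr.
by rewrite mulr1 subr_eq0 => /eqP->.
Qed.

Lemma lin_span_Caff a q : lin_span [:: toQ a; 1] q <-> Caff a q.
Proof.
split=> [[c Cc /lin_span1 Cq]|[c [d [Cc Cd ->]]]].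
  by exists c, (q - c * toQ a); split; rewrite // addrC subrK.
by exists c => //; apply/lin_span1; rewrite addrC addKr.
Qed.

Lemma Caff_free a : ~ C (toQ a) -> lin_free [:: toQ a; 1].
Proof.
move=> Ca; split; first by move/lin_span1.
by split=> //=; apply: Qs_nontrivial.
Qed.

Lemma Caff_ext_centroid a c : C c -> Caff a c.
Proof. by exists 0, c; split; rewrite ?mul0r ?add0r //; apply: ext_centroid0. Qed.

Lemma Caff_id a : Caff a (toQ a).
Proof.
exists 1, 0; rewrite mul1r addr0.
by split=> //; [apply: ext_centroid1|apply: ext_centroid0].
Qed.

Lemma CaffD a p q : Caff a p -> Caff a q -> Caff a (p + q).
Proof.
move=> [b [c [Cb Cc ->]]] [d [e [Cd Ce ->]]]; exists (b + d), (c + e).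
by split; [apply: ext_centroidD|apply: ext_centroidD|rewrite mulrDl addrACA].
Qed.

Lemma CaffZ a c q : C c -> Caff a q -> Caff a (c * q).
Proof.
move=> Cc [b [d [Cb Cd ->]]]; exists (c * b), (c * d).
by split; [apply: ext_centroidM|apply: ext_centroidM|rewrite mulrDr mulrA].
Qed.

Lemma CaffN a q : Caff a q -> Caff a (- q).
Proof.
by rewrite -mulN1r; apply: CaffZ; apply: ext_centroidN; apply: ext_centroid1.
Qed.

Lemma Caff_comm a q r : q * toQ a = toQ a * q -> Caff a r -> q * r = r * q.
Proof.
move=> qa [b [c [Cb Cc ->]]].
by rewrite mulrDr mulrDl -Cc mulrA -Cb -mulrA qa mulrA.
Qed.

Lemma Caff_commute a q r : Caff a q -> Caff a r -> q * r = r * q.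
Proof. by move=> aq; apply: Caff_comm; apply/esym/(Caff_comm _ aq). Qed.

Lemma CaffM a q r : C (toQ a * toQ a) -> Caff a q -> Caff a r -> Caff a (q * r).
Proof.
move=> Caa [b [c [Cb Cc ->]]] ar; rewrite mulrDl -mulrA.
apply: CaffD; apply: CaffZ => //; case: ar => d [e [Cd Ce ->]].
rewrite mulrDr mulrA -Cd -mulrA -Ce; apply: CaffD.
  by apply/CaffZ/Caff_ext_centroid.
exact/CaffZ/Caff_id.
Qed.

Lemma CaffS a b : Caff a (toQ b) -> Caff b `<=` Caff a.
Proof.
move=> ab _ [c [d [Cc Cd ->]]].
by apply: CaffD; [apply: CaffZ|apply: Caff_ext_centroid].
Qed.

(** * Commutator identities and powers of Lie ideals *)

(** The identity reads p k x w - p x k w - w p k x + w p x k = 0, with right factors w, k w, 1 and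
    k. If k w = d + c w + b k, the coefficient of k becomes w p - b p; otherwise the four factors
    are independent and p = 0. *)
Lemma commute_mod_Caff w k : ~ C (toQ w) -> ~ Caff w (toQ k) ->
  exists2 b, C b & forall p,
    (forall x, p * toQ (rcomm k x) * toQ w = toQ w * (p * toQ (rcomm k x))) ->
    toQ w * p = b * p.
Proof.
move=> Cw wk.
have fkw : lin_free [:: toQ k; toQ w; 1].
  by split; [rewrite lin_span_Caff|apply: Caff_free].
have [|nkw] := pselect (lin_span [:: toQ k; toQ w; 1] (toQ k * toQ w)).
  case=> b Cb [c Cc /lin_span1 Cd]; exists b => // p H.
  have {Cd}[d Cd kwE] : exists2 d, C d &
      toQ k * toQ w = d + c * toQ w + b * toQ k.
    by exists (toQ k * toQ w - b * toQ k - c * toQ w) => //; rewrite !subrK.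
  apply/eqP; rewrite -subr_eq0; apply/eqP.
  apply: (@gpi [:: (toQ w * p - b * p, toQ k); (p * toQ k - c * p, toQ w);
           (- (toQ w * p * toQ k) - d * p, 1)] fkw _ (_, toQ k)) => [x|];
    last by rewrite mem_head.
  have {}H : p * toQ k * toQ x * toQ w - p * toQ x * (d + c * toQ w + b * toQ k)
           - (toQ w * p * toQ k * toQ x - toQ w * p * toQ x * toQ k) = 0.
    rewrite -kwE -[RHS](subrr (toQ w * (p * toQ (rcomm k x)))) -{1}H.
    by rewrite toQ_rcomm !(mulrBr, mulrBl) !mulrA.
  rewrite !big_cons big_nil /= -[RHS]H !mulrDr !mulrA -!(Cb, Cc, Cd) !mulr1.
  rewrite !mulrBl !mulNr addr0 !opprD !opprK !addrA.
  by rewrite [LHS](ACl (3*6*4*2*5*1)) /= !mulrA.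
(* Here p = 0 is forced, so any scalar serves as b. *)
exists 0; first exact: ext_centroid0.
move=> p H.
suff -> : p = 0 by rewrite !mulr0.
apply: oppr_inj; rewrite oppr0.
apply: (@gpi [:: (- p, toQ k * toQ w); (toQ w * p, toQ k); (p * toQ k, toQ w);
   (- (toQ w * p * toQ k), 1)] _ _ (_, toQ k * toQ w)) => [//|x|];
  last by rewrite mem_head.
rewrite !big_cons big_nil /= -[RHS](subrr (toQ w * (p * toQ (rcomm k x)))) -{1}H.
rewrite toQ_rcomm !(mulrBr, mulrBl) !mulrA mulr1 !mulNr addr0.
by rewrite opprB !addrA [LHS](ACl (3*1*2*4)).
Qed.

(** In q k x - q x k = 0 the right factors 1 and k are independent. *)
Lemma annl_rcomm k q : ~ C (toQ k) ->
  (forall x, q * toQ (rcomm k x) = 0) -> q = 0.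
Proof.
move=> Ck H; apply: oppr_inj; rewrite oppr0.
apply: (@gpi [:: (- q, toQ k); (q * toQ k, 1)] (Caff_free Ck) _ (_, toQ k))
  => [x|]; last by rewrite mem_head.
rewrite !big_cons big_nil /= addr0 mulr1 !mulNr -[RHS](H x) toQ_rcomm mulrBr.
by rewrite addrC !mulrA.
Qed.

Lemma lie_ideal_rcomm L k x : lie_ideal L -> L k -> L (rcomm k x).
Proof. by move=> [_ HL] Lk; apply: HL; apply: sub_zgen; exists k, x. Qed.

Lemma noncentralP L : noncentral_lie_ideal L ->
  lie_ideal L /\ exists2 k, L k & ~ C (toQ k).
Proof.
move=> [lL ncL]; split=> //; apply: contrapT => H; apply: ncL => k Lk.
by apply/ext_centroid_toQ; apply: contrapT => Ck; apply: H; exists k.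
Qed.

Lemma set_comm_eq0 K L :
  set_comm K L = [set 0] <-> forall x y, K x -> L y -> x ** y = y ** x.
Proof.
split=> [H x y Kx Ly|H].
  have : set_comm K L (rcomm x y) by apply: sub_zgen; exists x, y.
  by rewrite H => xy0; apply/eqP; rewrite -subr_eq0; apply/eqP.
apply/seteqP; split=> [|_ ->]; last exact: (zgen_subgroup _).1.
apply: zgen_min => [|_ [x [y [Kx Ly ->]]] /=].
  by split=> // x y -> ->; rewrite /= subrr.
by rewrite /rcomm (H x y) // subrr.
Qed.

Lemma set_powS L m x y :
  set_pow L m.+1 x -> L y -> set_pow L m.+2 (x ** y).
Proof. by move=> Lx Ly; apply: sub_zgen; exists x, y. Qed.

Lemma set_pow_commute L m w : (forall k, L k -> k ** w = w ** k) ->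
  forall x, set_pow L m.+1 x -> x ** w = w ** x.
Proof.
move=> H; elim: m => [//|m IHm].
apply: (@zgen_min _ _ [set x | x ** w = w ** x]).
  split=> [|x y /= xw yw] /=; first by rewrite rmul0r rmulr0.
  by rewrite rmulBl rmulBr xw yw.
move=> _ [x [y [Lx Ly ->]]] /=.
by rewrite -rmulA (H _ Ly) rmulA (IHm _ Lx) rmulA.
Qed.

(** Commutators [k, x] lie in L, so [annl_rcomm] strips the power of one factor at a time. *)
Lemma set_pow_annl L m q : noncentral_lie_ideal L ->
  (forall x, set_pow L m.+1 x -> q * toQ x = 0) -> q = 0.
Proof.
move=> /noncentralP[lL [k Lk Ck]].
elim: m => [|m IHm] H.
  by apply: (annl_rcomm Ck) => x; apply: H; apply: lie_ideal_rcomm.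
apply: IHm => x Lx; apply: (annl_rcomm Ck) => y.
by rewrite -mulrA -toQM H //; apply: set_powS => //; apply: lie_ideal_rcomm.
Qed.

(** If w did not commute with k, then w would be noncentral and k outside C w + C. By
    [commute_mod_Caff], w - b would annihilate the next lower power of L, and [set_pow_annl] would
    make w = b central. *)
Lemma set_pow_centralizer L m w : noncentral_lie_ideal L ->
  (forall x, set_pow L m.+1 x -> x ** w = w ** x) ->
  forall k, L k -> k ** w = w ** k.
Proof.
case: m => [//|m] nL H k Lk; have [lL _] := noncentralP nL.
apply: contrapT => kw.
have Cw : ~ C (toQ w) by move/ext_centroid_toQ => Zw; apply/kw/esym/Zw.
have wk : ~ Caff w (toQ k).
  by move=> wk; apply: kw; apply: (@toQ_inj R); rewrite !toQM (Caff_commute wk) //;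
    apply: Caff_id.
have [b Cb Hb] := commute_mod_Caff Cw wk.
apply: Cw; suff /eqP : toQ w - b = 0 by rewrite subr_eq0 => /eqP->.
(* For x in L^(m+1), the product x [k, y] lies in L^(m+2), which commutes with w. *)
apply: (set_pow_annl nL (m := m)) => x Lx; rewrite mulrBl Hb ?subrr // => y.
rewrite -!toQM H //; apply: set_powS => //; exact: lie_ideal_rcomm.
Qed.

(** * Spans over C *)

Lemma Cspan_gen (A : set (Qs R)) q : A q -> Cspan A q.
Proof.
move=> Aq; exists 1, (fun=> 1), (fun=> q); split=> //.
  by move=> _; apply: ext_centroid1.
by rewrite big_ord1 mul1r.
Qed.

Lemma CspanD (A : set (Qs R)) p q : Cspan A p -> Cspan A q -> Cspan A (p + q).
Proof.
move=> [n [c [a [Cc Aa ->]]]] [m [d [b [Cd Ab ->]]]]; exists (n + m)%N.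
exists (fun i => match split i with inl j => c j | inr j => d j end).
exists (fun i => match split i with inl j => a j | inr j => b j end).
split=> [i|i|]; [by case: split|by case: split|].
rewrite big_split_ord; congr (_ + _); apply: eq_bigr => i _.
  by rewrite (unsplitK (inl i)).
by rewrite (unsplitK (inr i)).
Qed.

Lemma CspanZ (A : set (Qs R)) c q : C c -> Cspan A q -> Cspan A (c * q).
Proof.
move=> Cc [n [d [b [Cd Ab ->]]]]; exists n, (fun i => c * d i), b.
split=> // [i|]; first exact: ext_centroidM.
by rewrite mulr_sumr; apply: eq_bigr => i _; rewrite mulrA.
Qed.

Lemma Cspan_min (A V : set (Qs R)) : V 0 ->
  (forall p q, V p -> V q -> V (p + q)) ->
  (forall c q, C c -> V q -> V (c * q)) -> A `<=` V -> Cspan A `<=` V.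
Proof.
move=> V0 VD VZ AV _ [n [c [a [Cc Aa ->]]]].
by elim/big_ind: _ => // i _; apply: VZ => //; apply: AV.
Qed.

Lemma Cspan_sub_Caff L a : (forall x, L x -> Caff a (toQ x)) ->
  Cspan_sub L `<=` Caff a.
Proof.
move=> La; apply: Cspan_min.
- exact/Caff_ext_centroid/ext_centroid0.
- exact: CaffD.
- exact: CaffZ.
- by move=> _ [x Lx <-]; apply: La.
Qed.

Lemma Caff_eq0 a b c : ~ C (toQ a) -> C b -> C c -> b * toQ a + c = 0 ->
  b = 0 /\ c = 0.
Proof.
move=> Ca Cb Cc bac; have [b0|b0] := pselect (b = 0).
  by move: bac; rewrite b0 mul0r add0r.
have [d Cd db] := ext_centroid_inv Cb b0; case: Ca.
move/eqP: bac; rewrite addr_eq0 => /eqP bac.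
rewrite -(mul1r (toQ a)) -db -mulrA bac; apply: ext_centroidM => //.
exact: ext_centroidN.
Qed.

(** * First consequences of commutation *)

(** Otherwise [commute_mod_Caff] with p = 1 would give w = b, a scalar. *)
Lemma commuting_lie_ideals_Caff K L k w : lie_ideal K ->
  (forall x y, K x -> L y -> x ** y = y ** x) ->
  K k -> L w -> ~ C (toQ w) -> Caff w (toQ k).
Proof.
move=> lK KL Kk Lw Cw; apply: contrapT => wk.
have [b Cb Hb] := commute_mod_Caff Cw wk; apply: Cw.
rewrite -(mulr1 (toQ w)) Hb ?mulr1 // => x.
by rewrite mul1r -!toQM KL //; apply: lie_ideal_rcomm.
Qed.

(** In [a, [a, x]] = a^2 x - 2 a x a + x a^2 the right factor a^2 has coefficient 1, so 1, a, a^2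
    are dependent and a^2 = s a + t. The coefficient of a is then s - 2 a = 0, so 2 a is central,
    which forces 2 = 0 and s = 0. *)
Lemma rcomm_rcomm_eq0 a : ~ C (toQ a) -> (forall x, rcomm a (rcomm a x) = 0) ->
  (1 + 1 : Qs R) = 0 /\ C (toQ a * toQ a).
Proof.
move=> Ca H.
have {}H x : toQ a * toQ a * toQ x - (toQ a * toQ x * toQ a + toQ a * toQ x * toQ a)
    + toQ x * (toQ a * toQ a) = 0.
  rewrite -toQ0 -(H x) toQ_rcomm toQ_rcomm mulrBr mulrBl !mulrA opprB opprD.
  by rewrite !addrA [LHS](ACl (1*2*4*3)).
have [|naa] := pselect (lin_span [:: toQ a; 1] (toQ a * toQ a)); last first.
  have faa : lin_free [:: toQ a * toQ a; toQ a; 1] by split; [|apply: Caff_free].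
  case: (Qs_nontrivial).
  apply: (@gpi [:: (1, toQ a * toQ a); (- (toQ a + toQ a), toQ a);
            (toQ a * toQ a, 1)] faa _ (_, toQ a * toQ a)) => [x|];
    last by rewrite mem_head.
  rewrite !big_cons big_nil /= -[RHS](H x) addr0 mulr1 mul1r !mulNr !mulrDl.
  by rewrite addrC [X in X + _]addrC.
case=> s Cs /lin_span1 Ct.
have {Ct}[t Ct aaE] : exists2 t, C t & toQ a * toQ a = s * toQ a + t.
  by exists (toQ a * toQ a - s * toQ a); rewrite // addrC subrK.
have sE : s - (toQ a + toQ a) = 0.
  apply: (@gpi [:: (s - (toQ a + toQ a), toQ a); (toQ a * toQ a + t, 1)]
    (Caff_free Ca) _ (_, toQ a)) => [x|]; last by rewrite mem_head.
  rewrite !big_cons big_nil /= -[RHS](H x) addr0 mulr1 aaE !mulrBl !mulrDr !mulrDl.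
  rewrite -Ct mulrA -Cs.
  by rewrite [LHS](AC (2*3) ((3*4*2)*(1*5))).
have {}sE : s = (1 + 1) * toQ a.
  by apply/eqP; rewrite -subr_eq0 mulrDl mul1r sE.
have two0 : (1 + 1 : Qs R) = 0.
  apply: contrapT => two_neq0; case: Ca.
  have C2 : C (1 + 1) by apply: ext_centroidD; apply: ext_centroid1.
  have [d Cd d2] := ext_centroid_inv C2 two_neq0.
  by rewrite -(mul1r (toQ a)) -d2 -mulrA -sE; apply: ext_centroidM.
by split=> //; rewrite aaE sE two0 !mul0r add0r.
Qed.

(** * Characteristic two: spans of Lie ideals and the dimension of RC *)

Section CharacteristicTwo.

Hypothesis two0 : (1 + 1 : Qs R) = 0.

Lemma addqq q : q + q = 0.
Proof. by rewrite -(mul1r q) -mulrDl two0 mul0r. Qed.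

Lemma Caff_sqr a q : C (toQ a * toQ a) -> Caff a q -> C (q * q).
Proof.
move=> Caa [b [c [Cb Cc ->]]].
have -> : (b * toQ a + c) * (b * toQ a + c) = b * b * (toQ a * toQ a) + c * c.
  rewrite !mulrDl !mulrDr -(Cc (b * toQ a)) addrA -(addrA (_ * _)) addqq addr0.
  by rewrite -!mulrA (mulrA (toQ a)) -(Cb (toQ a)) !mulrA.
apply: ext_centroidD; last exact: ext_centroidM.
by apply: ext_centroidM => //; apply: ext_centroidM.
Qed.

(* If every [a, x]^2 were 0, a nonzero b = [a, x] would span every [a, y] over C,
   whence b R b = 0. *)
Lemma rcomm_sqr_neq0 a : ~ C (toQ a) -> C (toQ a * toQ a) ->
  (forall x, Caff a (toQ (rcomm a x))) ->
  exists x, toQ (rcomm a x) * toQ (rcomm a x) <> 0.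
Proof.
move=> Ca Caa Ha; apply: contrapT => H.
have sq0 x : toQ (rcomm a x) * toQ (rcomm a x) = 0.
  by apply: contrapT => x0; apply: H; exists x.
have [x ax0] : exists x, toQ (rcomm a x) <> 0.
  apply: contrapT => nx; case: (Qs_nontrivial); apply: (annl_rcomm Ca) => x.
  by rewrite mul1r; apply: contrapT => ax0; apply: nx; exists x.
apply: ax0; have := sq0 x; case: (Ha x) => l [m [Cl Cm]].
set b := toQ (rcomm a x) => bE bb0.
have [l0|l0] := pselect (l = 0).
  move: bE bb0; rewrite l0 mul0r add0r => -> mm0.
  by case: (ext_centroid_mul_eq0 Cm mm0).
suff [//|//] : b = 0 \/ b = 0.
apply: Qs_prime => y; have := sq0 y; have := Ha y.
set e := toQ (rcomm a y) => ae ee0; have [l' [m' [Cl' Cm' eE]]] := ae.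
(* The terms in a cancel, so the difference is a scalar; its square is 0 because b and e commute and
   square to 0, and 2 = 0. *)
have leE : l * e = l' * b.
  have nuE : l * e - l' * b = l * m' - l' * m.
    rewrite eE bE !mulrDr !mulrA (Cl l') opprD !addrA [LHS](ACl (1*3*2*4)).
    by rewrite /= subrr add0r.
  have Cnu : C (l * m' - l' * m).
    by apply: ext_centroidD; [|apply: ext_centroidN]; apply: ext_centroidM.
  suff /(ext_centroid_mul_eq0 Cnu) : (l * m' - l' * m) * (l * m' - l' * m) = 0.
    by rewrite -nuE => -[] /eqP; rewrite subr_eq0 => /eqP.
  have be : b * e = e * b by apply: Caff_commute ae; apply: Ha.
  rewrite -nuE mulrBl !mulrBr.
  have -> : l * e * (l * e) = 0 by rewrite -mulrA (mulrA e) -Cl -mulrA ee0 !mulr0.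
  have -> : l' * b * (l' * b) = 0.
    by rewrite -mulrA (mulrA b) -Cl' -mulrA bb0 !mulr0.
  have -> : l * e * (l' * b) = l' * b * (l * e).
    by rewrite -!mulrA (mulrA e) (mulrA b) -Cl' -Cl -!mulrA be !mulrA (Cl l').
  by rewrite sub0r subr0 -opprD addqq oppr0.
(* As b = l a + m, [b, y] = l e = l' b; left multiplication by b leaves b y b = 0. *)
apply: oppr_inj; rewrite oppr0.
have /(congr1 (fun q => b * q)) : b * toQ y - toQ y * b = l * e.
  rewrite /e toQ_rcomm bE mulrBr mulrDl mulrDr -Cm (mulrA (toQ y)) -(Cl (toQ y)).
  by rewrite opprD addrACA subrr addr0 !mulrA.
by rewrite leE mulrBr !mulrA bb0 mul0r -Cl' -(mulrA l') bb0 mulr0 sub0r.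
Qed.

(** As a lies in L, one nonzero scalar in LC suffices. Take w = [a, x] = b a + c with w^2 nonzero:
    if c is nonzero, c = w - b a will do; otherwise [a, x a] = b a^2 will, being nonzero because w^2
    = b^2 a^2. *)
Lemma Cspan_lie_ideal L a : lie_ideal L -> L a -> ~ C (toQ a) ->
  C (toQ a * toQ a) -> (forall x, L x -> Caff a (toQ x)) ->
  Cspan_sub L = Caff a.
Proof.
move=> lL La Ca Caa HL; have Lax x : L (rcomm a x) by apply: lie_ideal_rcomm.
have spL x : L x -> Cspan_sub L (toQ x) by move=> Lx; apply: Cspan_gen; exists x.
apply/seteqP; split; first exact: Cspan_sub_Caff.
suff [n [Cn n0 spn]] : exists n, [/\ C n, n <> 0 & Cspan_sub L n].
  move=> _ [b [c [Cb Cc ->]]]; have [d Cd dn] := ext_centroid_inv Cn n0.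
  apply: CspanD; first by apply: CspanZ => //; apply: spL.
  rewrite -(mulr1 c) -dn mulrA; apply: CspanZ => //; exact: ext_centroidM.
have [//|x] := rcomm_sqr_neq0 Ca Caa _; first by move=> x; apply: HL.
have [b [c [Cb Cc E]]] := HL _ (Lax x).
have [c0|c0] := pselect (c = 0); last first.
  move=> _; exists c; split=> //.
  have -> : c = toQ (rcomm a x) + - b * toQ a.
    by rewrite E mulNr addrC addKr.
  apply: CspanD; first exact: spL.
  by apply: CspanZ; [apply: ext_centroidN|apply: spL].
rewrite E c0 addr0 => ww0; exists (b * (toQ a * toQ a)).
split; first exact: ext_centroidM.
  move=> n0; apply: ww0.
  by rewrite -mulrA (mulrA (toQ a)) -(Cb (toQ a)) -mulrA n0 mulr0.
have -> : b * (toQ a * toQ a) = toQ (rcomm a (x ** a)); last exact: spL.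
rewrite mulrA -[b * toQ a]addr0 -c0 -E !toQ_rcomm !toQM mulrBl !mulrA.
by [].
Qed.

(** Elements are written e + f y with e and f in C a + C, a commutative ring because a^2 is a
    scalar. *)
Lemma Cdim4_Cspan a : ~ C (toQ a) -> C (toQ a * toQ a) ->
  (forall x, Caff a (toQ (rcomm a x))) -> Cspan_sub [set: R] 1 ->
  Cdim_eq (Cspan_sub [set: R]) 4.
Proof.
move=> Ca Caa Ha sp1; have [y ww0] := rcomm_sqr_neq0 Ca Caa Ha.
have spR x : Cspan_sub [set: R] (toQ x) by apply: Cspan_gen; exists x.
have Caw := Ha y.
have wE : toQ a * toQ y - toQ y * toQ a = toQ (rcomm a y) by rewrite toQ_rcomm.
move: ww0 Caw wE; set w := toQ (rcomm a y) => ww0 Caw wE.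
have Cww : C (w * w) := Caff_sqr Caa Caw.
pose b (i : 'I_4) := nth 0 [:: 1; toQ a; toQ y; toQ a * toQ y] i.
have spb i : Cspan (range b) (b i) by apply: Cspan_gen; exists i.
exists b; split.
  move=> c Cc; rewrite !big_ord_recl big_ord0 /b /=.
  set c3 := c (lift _ (lift _ (lift _ _))); set c2 := c (lift _ (lift _ _)).
  set c1 := c (lift _ _); set c0 := c ord0 => H.
  have [C0 C1 C2 C3] : [/\ C c0, C c1, C c2 & C c3] by split; apply: Cc.
  pose e := c1 * toQ a + c0; pose f := c3 * toQ a + c2.
  have Cae : Caff a e by exists c1, c0.
  have Caf : Caff a f by exists c3, c2.
  have ef0 : e + f * toQ y = 0.
    rewrite -[RHS]H mulr1 addr0 mulrDl !mulrA.
    by rewrite [LHS](AC (2*2) (2*(1*(4*3)))).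
  (* Commuting e + f y = 0 with a gives f w = 0, and w^2 is a nonzero scalar. *)
  have f0 : f = 0.
    suff : w * w * f = 0 by case/ext_centroid_mul_eq0.
    rewrite Cww mulrA; suff -> : f * w = 0 by rewrite mul0r.
    rewrite -wE mulrBr !mulrA (Caff_commute Caf (Caff_id a)).
    have fyE : f * toQ y = - e by apply/eqP; rewrite -subr_eq0 opprK addrC ef0.
    rewrite -(mulrA (toQ a)) fyE mulrN mulNr (Caff_commute Cae (Caff_id a)) opprK.
    by rewrite addNr.
  move: ef0; rewrite f0 mul0r addr0 => e0.
  have [c30 c20] := Caff_eq0 Ca C3 C2 f0; have [c10 c00] := Caff_eq0 Ca C1 C0 e0.
  move=> [[|[|[|[|//]]]] ltk4].
  - by rewrite -[RHS]c00; congr c; apply: val_inj.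
  - by rewrite -[RHS]c10; congr c; apply: val_inj.
  - by rewrite -[RHS]c20; congr c; apply: val_inj.
  - by rewrite -[RHS]c30; congr c; apply: val_inj.
have [d Cd dww] := ext_centroid_inv Cww ww0.
have rcommM u v : toQ (rcomm a (u ** v)) =
    toQ (rcomm a u) * toQ v + toQ u * toQ (rcomm a v).
  by rewrite !toQ_rcomm !toQM mulrBl mulrBr !mulrA addrA subrK.
apply/seteqP; split; apply: Cspan_min.
- by rewrite -(mul0r (b ord0)); apply: CspanZ => //; apply: ext_centroid0.
- exact: CspanD.
- exact: CspanZ.
(* With d inverse to w^2, this e satisfies [a, x] = e w; the claim is then that x - e y lies in C a
   + C. *)
- move=> _ [x _ <-]; pose e := d * (toQ (rcomm a x) * w).
  have Cae : Caff a e by apply: CaffZ => //; apply: CaffM.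
  have ew : e * w = toQ (rcomm a x).
    by rewrite /e -mulrA -(mulrA _ w) Cd -mulrA -Cd dww mulr1.
  (* Membership is checked after multiplying by w, whose inverse is d w: (x - e y) w = [a, x y] - e
     [a, y^2], as the terms e w y cancel. *)
  have Caz : Caff a (toQ x - e * toQ y).
    rewrite -(mulr1 (_ - _)) -dww Cd mulrA mulrA -Cd; apply: CaffZ => //.
    apply: CaffM => //; rewrite mulrBl.
    have -> : toQ x * w - e * toQ y * w =
        toQ (rcomm a (x ** y)) - e * toQ (rcomm a (y ** y)).
      rewrite !rcommM -ew -/w mulrDr !mulrA opprD addrACA.
      by rewrite subrr add0r.
    by apply: CaffD => //; apply: CaffN; apply: CaffM.
  rewrite -(subrK (e * toQ y) (toQ x)); move: Caz Cae.
  move=> [c0 [c1 [C0 C1 ->]]] [c2 [c3 [C2 C3 ->]]].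
  rewrite mulrDl -mulrA -(mulr1 c1); apply: CspanD; apply: CspanD.
  - exact: (CspanZ C0 (spb (@Ordinal 4 1 isT))).
  - exact: (CspanZ C1 (spb (@Ordinal 4 0 isT))).
  - exact: (CspanZ C2 (spb (@Ordinal 4 3 isT))).
  - exact: (CspanZ C3 (spb (@Ordinal 4 2 isT))).
- by rewrite -(mul0r 1); apply: CspanZ => //; apply: ext_centroid0.
- exact: CspanD.
- exact: CspanZ.
(* R may lack a unity: the basis vector 1 lies in RC by [sp1]. *)
- move=> _ [[[|[|[|[|//]]]] ltk4] _ <-]; rewrite /b /= -?toQM //; exact: spR.
Qed.

End CharacteristicTwo.


(** * Exceptionality from commuting Lie ideals, and the equivalences *)

Lemma commuting_lie_ideals_exceptional K L a :
  noncentral_lie_ideal K -> lie_ideal L ->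
  (forall x y, K x -> L y -> x ** y = y ** x) -> L a -> ~ C (toQ a) ->
  [/\ exceptional R, Cspan_sub K = Cspan_sub L & Cspan_sub L = Caff a].
Proof.
move=> /noncentralP[lK [k Kk Ck]] lL KL La Ca.
have LK x y : L x -> K y -> x ** y = y ** x by move=> Lx Ky; rewrite (KL y).
have HL x : L x -> Caff k (toQ x).
  by move=> Lx; apply: (commuting_lie_ideals_Caff lL LK).
have HK x : K x -> Caff a (toQ x).
  by move=> Kx; apply: (commuting_lie_ideals_Caff lK KL).
have akE : Caff a = Caff k.
  by apply/seteqP; split; apply: CaffS; [apply: HL|apply: HK].
(* The commutator [a, x] lies in L, so it commutes with k, hence with a, which lies in C k + C. *)
have [x|two0 Caa] := @rcomm_rcomm_eq0 a Ca.
  apply/eqP; rewrite /rcomm subr_eq0; apply/eqP; apply: (@toQ_inj R).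
  rewrite !toQM; apply/esym; apply: (@Caff_comm k); last exact: HL.
  by rewrite -!toQM LK //; apply: lie_ideal_rcomm.
have spL : Cspan_sub L = Caff a.
  by apply: Cspan_lie_ideal => // x Lx; rewrite akE; apply: HL.
have spK : Cspan_sub K = Caff k.
  apply: Cspan_lie_ideal => //; last by move=> x Kx; rewrite -akE; apply: HK.
  by apply: (Caff_sqr two0 Caa); apply: HK.
split=> //; last by rewrite spK spL akE.
split=> [x|]; first by apply: (@toQ_inj R); rewrite mulr2n toQD toQ0 addqq.
apply: (@Cdim4_Cspan two0 a) => // [x|].
  by rewrite akE; apply: HL; apply: lie_ideal_rcomm.
(* The unit 1 lies in C a + C = LC, and LC is contained in RC. *)
have : Cspan_sub L 1 by rewrite spL; apply/Caff_ext_centroid/ext_centroid1.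
apply: Cspan_min.
- rewrite -(mul0r (toQ a)); apply: CspanZ; first exact: ext_centroid0.
  by apply: Cspan_gen; exists a.
- exact: CspanD.
- exact: CspanZ.
- by move=> _ [x _ <-]; apply: Cspan_gen; exists x.
Qed.

End PrimeRings.

Theorem theoremC (R : primeRngType) (K L : set R)
    (hK : noncentral_lie_ideal K) (hL : noncentral_lie_ideal L)
    (m n : nat) (hm : (0 < m)%N) (hn : (0 < n)%N) :
  (set_comm (set_pow K m) (set_pow L n) = [set 0] <->
   set_comm K L = [set 0]) /\
  (set_comm K L = [set 0] <->
   exceptional R /\
   forall a : R, L a -> ~ rcenter a ->
     Cspan_sub K = Cspan_sub L /\ Cspan_sub L = Caff a).
Proof.
case: m n hm hn => [//|m] [//|n] _ _; have [lL [a La Ca]] := noncentralP hL.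
split; rewrite !set_comm_eq0; split.
(* Two uses of the centralizer lemma: x commutes with L once it commutes with each z in L^n, and
   such a z commutes with K because it commutes with K^m. *)
- move=> H x y Kx Ly; apply/esym.
  apply: (set_pow_centralizer hL (m := n)) Ly => z Lz.
  by apply/esym; apply: (set_pow_centralizer hK (m := m)) Kx => t Kt; apply: H.
- move=> H x y Kx Ly; apply: set_pow_commute Kx => z Kz.
  by apply/esym; apply: set_pow_commute Ly => t Lt; rewrite (H z).
- move=> H; have HC b := @commuting_lie_ideals_exceptional R K L b hK lL H.
  split=> [|b Lb /ext_centroid_toQ Cb]; first by have [] := HC a La Ca.
  by have [] := HC b Lb Cb.
(* Both K and L lie in C a + C, whose elements commute. *)
- move=> [_ H] x y Kx Ly.
  have [KLE LE] : Cspan_sub K = Cspan_sub L /\ Cspan_sub L = Caff a.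
    by apply: H => // Za; apply/Ca/ext_centroid_toQ.
  apply: (@toQ_inj R); rewrite !toQM; apply: (@Caff_commute _ a); rewrite -LE.
    by rewrite -KLE; apply: Cspan_gen; exists x.
  by apply: Cspan_gen; exists y.
Qed.
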